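(* Let $\Omega$ be a non-empty set, let $X_n, X:\Omega\to\mathbb{R}$, $n\in\mathbb{N}$, be functions and let $P_\lambda$ be a possibility measure on $\Omega$. If $X_n$ converges to $X$ in the possibility measure $P_\lambda$, then $X_n$ converges to $X$ almost everywhere with respect to the possibility measure $P_\lambda$.
   Context: A possibility measure on a non-empty set $\Omega$ is a mapping $P:\mathcal{P}(\Omega)\to[0,1]$, defined on all subsets of $\Omega$, with $P(\emptyset)=0$, $P(\Omega)=1$ and $P(\bigcup_{i\in I}A_i)=\sup\{P(A_i):i\in I\}$ for every family $(A_i)_{i\in I}$ of subsets of $\Omega$ with arbitrary index set $I$ (for empty $I$ the supremum is taken to be $0$). The notation $P_\lambda$ refers to the possibility measure $P_\lambda(A)=\sup\{\lambda(s):s\in A\}$ induced by a possibility distribution $\lambda:\Omega\to[0,1]$, i.e. a function with $\sup_{s\in\Omega}\lambda(s)=1$. $X_n$ converges to $X$ in the possibility measure $P_\lambda$ if for every $\varepsilon>0$, $\lim_{n\to\infty}P_\lambda(\{\omega\in\Omega:|X_n(\omega)-X(\omega)|\ge\varepsilon\})=0$. $X_n$ converges to $X$ almost everywhere with respect to $P_\lambda$ if $P_\lambda(\{\omega\in\Omega:X_n(\omega)\not\to X(\omega)\})=0$, where $X_n(\omega)\not\to X(\omega)$ means that $(X_n(\omega))_n$ either has no limit or has a limit different from $X(\omega)$. *)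

(* Defs.v *)
From mathcomp Require Import all_boot all_order all_algebra.
From mathcomp Require Import all_classical all_reals all_analysis.

Set Implicit Arguments.
Unset Strict Implicit.
Unset Printing Implicit Defensive.

Import Order.TTheory GRing.Theory Num.Theory.
Import numFieldNormedType.Exports.

Local Open Scope classical_set_scope.
Local Open Scope ring_scope.

(* For I empty, the supremum in [possibility_sup] is [sup set0 = 0] (lemma
   [sup0]), which is the convention wanted here. *)
Record possibility_measure (R : realType) (Omega : Type) (P : set Omega -> R) :
    Prop := PossibilityMeasure {
  possibility_itv : forall A, 0 <= P A <= 1 ;
  possibility_set0 : P set0 = 0 ;
  possibility_setT : P setT = 1 ;
  possibility_sup : forall (I : Type) (A : I -> set Omega),
    P (\bigcup_i A i) = sup (range (fun i => P (A i))) }.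

Record possibility_distribution (R : realType) (Omega : Type)
    (lambda : Omega -> R) : Prop := PossibilityDistribution {
  distribution_itv : forall s, 0 <= lambda s <= 1 ;
  distribution_sup : sup (range lambda) = 1 }.

Definition possibility_of (R : realType) (Omega : Type) (lambda : Omega -> R)
  (A : set Omega) : R := sup (lambda @` A).

Definition cvg_in_possibility (R : realType) (Omega : Type)
    (P : set Omega -> R) (X_ : nat -> Omega -> R) (X : Omega -> R) : Prop :=
  forall eps : R, 0 < eps ->
    P [set omega | `|X_ n omega - X omega| >= eps] @[n --> \oo] --> (0 : R).

Definition cvg_ae_possibility (R : realType) (Omega : Type)
    (P : set Omega -> R) (X_ : nat -> Omega -> R) (X : Omega -> R) : Prop :=
  P [set omega | ~ (X_ n omega @[n --> \oo] --> X omega)] = 0.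

Lemma possibility_of_measure (R : realType) (Omega : Type)
    (lambda : Omega -> R) :
  possibility_distribution lambda ->
  possibility_measure (possibility_of lambda).
Proof.
move=> [l01 lsup].
have ub1 A : ubound (lambda @` A) 1.
  by move=> _ [s _ <-]; have /andP[] := l01 s.
have ub A : has_ubound (lambda @` A) by exists 1; exact: ub1.
have P0 : possibility_of lambda set0 = 0.
  by rewrite /possibility_of image_set0 sup0.
have Pge A s : A s -> lambda s <= possibility_of lambda A.
  by move=> As; apply: ub_le_sup => //; exists s.
have P01 A : 0 <= possibility_of lambda A <= 1.
  have [->|/set0P[s As]] := eqVneq A set0; first by rewrite P0 lexx ler01.
  apply/andP; split.
    by apply: le_trans (Pge _ _ As); have /andP[] := l01 s.
  by apply: ge_sup => //; exists (lambda s); exists s.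
split => // I A.
have ubP : has_ubound (range (fun i => possibility_of lambda (A i))).
  by exists 1 => _ [i _ <-]; have /andP[] := P01 (A i).
apply/eqP; rewrite eq_le; apply/andP; split.
- have [E|/set0P[s As]] := eqVneq (\bigcup_i A i) set0.
    rewrite E P0; have [->|/set0P[x rx]] := eqVneq
      (range (fun i => possibility_of lambda (A i))) set0; first by rewrite sup0.
    apply: le_trans (ub_le_sup ubP rx).
    by case: rx => i _ <-; have /andP[] := P01 (A i).
  apply: ge_sup; first by exists (lambda s); exists s.
  move=> _ [t [i _ At] <-]; apply: le_trans (Pge _ _ At) _.
  by apply: ub_le_sup => //; exists i.
- have [->|rn0] := eqVneq (range (fun i => possibility_of lambda (A i))) set0.
    by rewrite sup0; have /andP[] := P01 (\bigcup_i A i).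
  apply: ge_sup; first exact/set0P.
  move=> _ [i _ <-].
  have [->|/set0P[s As]] := eqVneq (A i) set0.
    by rewrite P0; have /andP[] := P01 (\bigcup_i A i).
  apply: ge_sup; first by exists (lambda s); exists s.
  by move=> _ [t At <-]; apply: Pge; exists i.
Qed.

(* Main.v *)
(** If [lambda s > 0], then convergence in possibility eventually makes the
    possibility of [|X_n - X| >= eps] smaller than [lambda s], so [s] itself
    leaves that set: [X_n s] converges to [X s]. Hence [lambda] vanishes on the
    divergence set, and so does its supremum there. *)
Require Import Defs.
From mathcomp Require Import all_boot all_order all_algebra.
From mathcomp Require Import all_classical all_reals all_analysis.
Import Order.TTheory GRing.Theory Num.Theory.
Import numFieldNormedType.Exports.

Local Open Scope classical_set_scope.

Lemma le_possibility_of (R : realType) (Omega : Type) (lambda : Omega -> R)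
    (A : set Omega) (s : Omega) :
  possibility_distribution lambda -> A s ->
  (lambda s <= possibility_of lambda A)%R.
Proof.
move=> [l01 _] As; apply: ub_le_sup; last by exists s.
(* Boundedness matters here: [sup] of an unbounded set is a default value, which need not dominate
   [lambda s]. *)
by exists 1%R => _ [t _ <-]; have /andP[] := l01 t.
Qed.

Lemma possibility_of_eq0 (R : realType) (Omega : Type) (lambda : Omega -> R)
    (A : set Omega) :
  (forall s, A s -> lambda s = 0%R) -> possibility_of lambda A = 0%R.
Proof.
move=> lA0; rewrite /possibility_of.
(* On the empty set the value is the convention [sup set0 = 0]; only a nonempty [A] has image
   exactly [{0}]. *)
have [->|/set0P[s As]] := eqVneq A set0; first by rewrite image_set0 sup0.
suff -> : lambda @` A = [set 0%R] by rewrite sup1.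
apply/seteqP; split=> [_ [t At <-]|_ ->]; first exact: lA0.
by exists s => //; exact: lA0.
Qed.

Lemma cvg_in_possibility_pointwise (R : realType) (Omega : Type)
    (X_ : nat -> Omega -> R) (X : Omega -> R) (lambda : Omega -> R)
    (s : Omega) :
  possibility_distribution lambda ->
  cvg_in_possibility (possibility_of lambda) X_ X ->
  (0 < lambda s)%R -> X_ n s @[n --> \oo] --> X s.
Proof.
move=> ldistr XP ls0; apply/cvgrPdist_lt => eps eps0.
(* [eps] is the deviation threshold, while [lambda s] serves as the tolerance for the possibilities
   tending to 0. *)
have /cvgrPdist_lt/(_ _ ls0) := XP eps eps0; apply: filterS => n.
rewrite sub0r normrN => Pn; rewrite distrC ltNge; apply/negP => dev.
(* By [dev], [s] lies in the deviation set, whose possibility is then at least [lambda s], against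
   [Pn]. *)
move: Pn; apply/negP; rewrite -leNgt; apply: le_trans (ler_norm _).
exact: le_possibility_of.
Qed.

Theorem corollary2p6 (R : realType) (Omega : Type)
    (Omega_neq0 : [set: Omega] !=set0)
    (X_ : nat -> Omega -> R) (X : Omega -> R)
    (lambda : Omega -> R) (lambda_distr : possibility_distribution lambda) :
  cvg_in_possibility (possibility_of lambda) X_ X ->
  cvg_ae_possibility (possibility_of lambda) X_ X.
Proof.
move=> XP; apply: possibility_of_eq0 => s /= ndiv.
(* Contraposition: as [lambda] is nonnegative, a nonzero [lambda s] is positive and forces
   convergence at [s]. *)
apply/eqP; apply: contra_notT ndiv => ls0.
apply: (cvg_in_possibility_pointwise _ _ _ _ _ _ lambda_distr XP).
by rewrite lt0r ls0; have /andP[] := distribution_itv lambda_distr s.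
Qed.
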